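(* Let $q=p^e$ with $p$ a prime, and suppose $q\equiv 1 \pmod 6$. Let $c,d\in\mathbb{F}_q$ with $c\neq 0$ be such that $E_1: y^2=x^3+cx^2+d$ is an elliptic curve over $\mathbb{F}_q$. Let $T$ be a generator of the character group $\widehat{\mathbb{F}_q^{\times}}$. Then $$a_q(E_1)=-q\,T^{\frac{q-1}{2}}(-3c)\;{}_{2}F_1\left(\begin{array}{cc} T^{\frac{q-1}{6}}, & T^{\frac{5(q-1)}{6}}\\ & \epsilon\end{array}\Big|\, -\frac{27d}{4c^3}\right),$$ where $\epsilon$ is the trivial character.
   Context: Every multiplicative character $\chi$ of $\mathbb{F}_q^{\times}$ (including the trivial character $\epsilon$) is extended to $\mathbb{F}_q$ by $\chi(0):=0$. For characters $A,B$ of $\mathbb{F}_q^{\times}$, define ${A \choose B}:=\frac{B(-1)}{q}\sum_{x\in\mathbb{F}_q}A(x)\overline{B}(1-x)$, where $\overline{B}$ is the inverse character. Greene's Gaussian hypergeometric series is ${}_{2}F_1\left(\begin{array}{cc} A_0, & A_1\\ & B_1\end{array}\Big|\, x\right):=\frac{q}{q-1}\sum_{\chi}{A_0\chi \choose \chi}{A_1\chi \choose B_1\chi}\chi(x)$ for $x\in\mathbb{F}_q$, the sum over all characters $\chi$ of $\mathbb{F}_q^{\times}$. The trace of Frobenius is $a_q(E)=q+1-\#E(\mathbb{F}_q)$, where $\#E(\mathbb{F}_q)$ counts the $\mathbb{F}_q$-points including the point at infinity. Powers of characters are pointwise, e.g. $T^{m}(x)=T(x)^m$. *)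

(* Defs.v *)
From HB Require Import structures.
From mathcomp Require Export all_boot all_order all_algebra.
From mathcomp Require Export all_fingroup all_solvable all_field all_character.

Set Implicit Arguments.
Unset Strict Implicit.
Unset Printing Implicit Defensive.

Import GRing.Theory Num.Theory.
Local Open Scope ring_scope.

(** ** Multiplicative characters *)

(* Linear characters of the unit group are the homomorphisms F^* -> algC^*
   (roots of unity, so algC loses nothing with respect to the complex numbers).
   Products, powers, inverses and the trivial character 1 of class functions
   are all pointwise. *)
Notation units_grp F := [set: {unit F}]%G.
Notation mulcf F := 'CF(units_grp F).

(* chi extended to F by chi(0) = 0; [insub] lifts x : F to {unit F} when x is
   invertible. *)
Definition char_ext (F : finFieldType) (chi : mulcf F) (x : F) : algC :=
  if insub x is Some u then chi u else 0.

Definition char_generator (F : finFieldType) (T : mulcf F) : Prop :=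
  T \is a linear_char /\
  forall chi : mulcf F, chi \is a linear_char -> exists n : nat, chi = T ^+ n.

(** ** Greene's hypergeometric series *)

Definition greene_binom (F : finFieldType) (A B : mulcf F) : algC :=
  char_ext B (-1) / #|F|%:R
  * \sum_(x : F) char_ext A x * char_ext B^-1 (1 - x).

(* Every linear character is irreducible, so filtering the enumeration
   ['chi_i] of the irreducible characters by [linear_char] makes [chi] range
   exactly once over all the characters of F^*. *)
Definition greene_2F1 (F : finFieldType) (A0 A1 B1 : mulcf F) (x : F) : algC :=
  #|F|%:R / (#|F|%:R - 1)
  * \sum_(i : Iirr (units_grp F) | 'chi_i \is a linear_char)
      greene_binom (A0 * 'chi_i) 'chi_i
      * greene_binom (A1 * 'chi_i) (B1 * 'chi_i)
      * char_ext 'chi_i x.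

(** ** Weierstrass curves *)

(* y^2 + a1 x y + a3 y = x^3 + a2 x^2 + a4 x + a6 *)
Record weierstrass (K : Type) := Weierstrass {
  wa1 : K; wa2 : K; wa3 : K; wa4 : K; wa6 : K }.

Definition map_weierstrass (K L : Type) (f : K -> L) (E : weierstrass K) :=
  Weierstrass (f (wa1 E)) (f (wa2 E)) (f (wa3 E)) (f (wa4 E)) (f (wa6 E)).

Definition on_curve (K : fieldType) (E : weierstrass K) (x y : K) : bool :=
  y ^+ 2 + wa1 E * x * y + wa3 E * y
  == x ^+ 3 + wa2 E * x ^+ 2 + wa4 E * x + wa6 E.

(* Both partial derivatives of the affine equation vanish at (x, y). *)
Definition singular_at (K : fieldType) (E : weierstrass K) (x y : K) : bool :=
  [&& on_curve E x y,
      wa1 E * y - (3 * x ^+ 2 + 2 * wa2 E * x + wa4 E) == 0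
    & 2 * y + wa1 E * x + wa3 E == 0].

(* Smoothness of the projective curve: no singular point over any extension of
   K (in particular over an algebraic closure). The point at infinity [0:1:0]
   needs no condition: the partial derivative in Z of the homogeneous equation
   is 1 there. *)
Definition elliptic (K : fieldType) (E : weierstrass K) : Prop :=
  forall (L : fieldType) (f : {rmorphism K -> L}) (x y : L),
    ~~ singular_at (map_weierstrass f E) x y.

(* [None] is the point at infinity. *)
Definition curve_points (F : finFieldType) (E : weierstrass F) :
    {set option (F * F)} :=
  [set P | if P is Some (x, y) then on_curve E x y else true].

Definition trace_frobenius (F : finFieldType) (E : weierstrass F) : int :=
  #|F|%:Z + 1 - #|curve_points E|%:Z.

(* Main.v *)
(* Put [S = T^((q-1)/6)], [rho = S^5], [omega = S^2], [phi = S^3] and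
   [x = -27d/(4c^3)].  Everything is reduced to the single sum
   [Sigma = sum_u rho(u) phi((u+1)^2 - 4xu)].

   Hypergeometric side: by orthogonality of characters, [q * 2F1] is the sum of
   [rho(b/a)] over the solutions of [a b x = (1-a)(1-b)].  Eliminating [a], the
   equation [b/a = u] is quadratic in [b], with discriminant
   [(u-1)^2 + 4xu]; replacing [u] by [-u] gives [phi(-1) * Sigma].

   Elliptic side: [a_q = - sum_t phi(t^3 + c t^2 + d)], and the substitution
   [t = (c/3)(s-1)] turns [t^3 + c t^2] into [(c^3/27)(s^3 - 3s + 2)].  A
   finite-field Cardano formula counts the roots of [s^3 - 3s = m] as
   [1 + sum_{u + 1/u = m} omega(u)], and
   [(c^3/27)(u + 1/u + 2) + d] is [3cu((u+1)^2 - 4xu)] up to a square, so the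
   sum equals [phi(3c) * Sigma].  The Cardano formula follows from
   [s = w + 1/w, u = w^3] where [s^2 - 4] is a square, and from the bijectivity
   of [s^3 - 3s] where it is not. *)
Require Import Defs.
From mathcomp Require Import ring zify.
Set Implicit Arguments.
Unset Strict Implicit.
Unset Printing Implicit Defensive.
Import GRing.Theory Num.Theory.
Local Open Scope ring_scope.

(** * Characters extended by zero, and their orthogonality *)

Section CharExt.
Variable F : finFieldType.
Implicit Types (chi : mulcf F) (x y : F) (u : {unit F}).

Lemma char_ext_val chi u : char_ext chi (val u) = chi u.
Proof. by rewrite /char_ext valK. Qed.

Lemma unit_of_neq0 x : x != 0 -> exists u : {unit F}, x = val u.
Proof. by rewrite -unitfE => Ux; exists (FinRing.Unit Ux). Qed.

Lemma char_ext0 chi : char_ext chi 0 = 0.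
Proof. by rewrite /char_ext insubF // unitr0. Qed.

Lemma char_ext_id x : x != 0 -> char_ext (1 : mulcf F) x = 1.
Proof. by case/unit_of_neq0 => u ->; rewrite char_ext_val cfun1E inE. Qed.

Lemma char_ext_mul chi psi x :
  char_ext (chi * psi) x = char_ext chi x * char_ext psi x.
Proof.
have [->|/unit_of_neq0[u ->]] := eqVneq x 0; first by rewrite !char_ext0 mul0r.
by rewrite !char_ext_val cfunE.
Qed.

Lemma char_ext_exp chi n x :
  x != 0 -> char_ext (chi ^+ n) x = char_ext chi x ^+ n.
Proof. by case/unit_of_neq0 => u ->; rewrite !char_ext_val exp_cfunE ?inE. Qed.

Section Linear.
Variable chi : mulcf F.
Hypothesis lin_chi : chi \is a linear_char.

Lemma char_ext1 : char_ext chi 1 = 1.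
Proof. by rewrite -[1]/(val (1%g : {unit F})) char_ext_val lin_char1. Qed.

Lemma char_extM : {morph char_ext chi : x y / x * y}.
Proof.
move=> x y.
have [->|/unit_of_neq0[u ->]] := eqVneq x 0; first by rewrite mul0r !char_ext0 mul0r.
have [->|/unit_of_neq0[v ->]] := eqVneq y 0; first by rewrite mulr0 !char_ext0 mulr0.
by rewrite -[val u * val v]/(val (u * v)%g) !char_ext_val lin_charM ?inE.
Qed.

Lemma char_extX n x : char_ext chi (x ^+ n) = char_ext chi x ^+ n.
Proof.
by elim: n => [|n IHn]; rewrite ?expr0 ?char_ext1 // !exprS char_extM IHn.
Qed.

Lemma char_ext_neq0 x : x != 0 -> char_ext chi x != 0.
Proof. by case/unit_of_neq0 => u ->; rewrite char_ext_val lin_char_neq0 ?inE. Qed.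

Lemma char_ext_inv x : char_ext chi^-1 x = char_ext chi x^-1.
Proof.
have [->|nz_x] := eqVneq x 0; first by rewrite invr0 !char_ext0.
apply: (mulIf (char_ext_neq0 nz_x)).
rewrite -char_ext_mul -char_extM mulVf // char_ext1.
by rewrite mulVr ?char_ext_id // lin_char_unitr.
Qed.

(** Scaling the summation variable by [y] multiplies the sum by [chi y], which is not 1. *)
Lemma char_ext_sum0 y : y != 0 -> char_ext chi y != 1 -> \sum_x char_ext chi x = 0.
Proof.
move=> nz_y chi_y; pose S := \sum_x char_ext chi x.
have: char_ext chi y * S = S.
  rewrite mulr_sumr [RHS](reindex_inj (mulfI nz_y)).
  by apply: eq_bigr => x _; rewrite char_extM.
move/eqP; rewrite -[X in _ == X]mul1r -subr_eq0 -mulrBl mulf_eq0 subr_eq0.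
by rewrite (negPf chi_y) => /eqP.
Qed.
End Linear.

(** This is the second orthogonality relation between [u] and the identity. The unit group is
    cyclic, so every irreducible character is linear and the filter drops nothing. *)
Lemma char_ext_orthogonality x :
  \sum_(i : Iirr (units_grp F) | 'chi_i \is a linear_char) char_ext 'chi_i x
  = (#|F|%:R - 1) * (x == 1)%:R.
Proof.
have [->|nz_x] := eqVneq x 0.
  by rewrite eq_sym oner_eq0 mulr0 big1 // => i _; rewrite char_ext0.
have lin i : 'chi[units_grp F]_i \is a linear_char.
  exact/irr_cyclic_lin/field_unit_group_cyclic.
case/unit_of_neq0: nz_x => u ->.
have := second_orthogonality_relation u (group1 (units_grp F)).
rewrite class1G inE => sum_u.
transitivity (\sum_(i : Iirr (units_grp F)) 'chi_i u * ('chi_i 1%g)^*).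
  apply: eq_big => [i|i _]; first by rewrite lin.
  by rewrite char_ext_val lin_char1 // rmorph1 mulr1.
rewrite sum_u -[1 : F]/(val (1%g : {unit F})) (inj_eq val_inj).
case: eqP => [->|_]; rewrite ?mulr0 // mulr1.
have ->: #|'C_(units_grp F)[1]%g| = #|F|.-1.
  by rewrite cent11T setIT -card_finField_unit.
by rewrite mulr1n -subn1 natrB // (cardD1 0) inE.
Qed.

End CharExt.

(** * Power residues detected by a generator of the character group *)

Section PowerResidue.
Variable F : finFieldType.

Lemma finField_expf_pred x : x != 0 -> x ^+ #|F|.-1 = 1 :> F.
Proof.
move=> nz_x; apply: (mulfI nz_x); rewrite -exprS prednK ?expf_card ?mulr1 //.
exact: ltnW (finNzRing_gt1 F).
Qed.

Lemma finField_prim_root : exists g : F, #|F|.-1.-primitive_root g.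
Proof.
have cardF: (1 < #|F|)%N by exact: finNzRing_gt1.
have /hasP[g _ prim_g]: has #|F|.-1.-primitive_root (enum (predC1 (0 : F))).
  apply: has_prim_root; first lia.
  - apply/allP => x; rewrite mem_enum inE => nz_x; apply/unity_rootP.
    exact: finField_expf_pred.
  - exact: enum_uniq.
  - by rewrite -cardE cardC1.
by exists g.
Qed.

Lemma prim_root_log (g : F) x : #|F|.-1.-primitive_root g -> x != 0 ->
  exists i : nat, x = g ^+ i.
Proof.
move=> prim_g /finField_expf_pred x1.
by have [i ->] := prim_rootP prim_g x1; exists i.
Qed.

Variable T : mulcf F.
Hypothesis T_gen : char_generator T.
Let lin_T : T \is a linear_char := proj1 T_gen.

(** If [T] is 1 at [x], so is every character, being a power of [T]. The orthogonality sum at [x] is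
    then the number of characters, which is nonzero, and this forces [x = 1]. *)
Lemma char_generator_inj x : char_ext T x = 1 -> x = 1.
Proof.
have [->|nz_x Tx] := eqVneq x 0.
  by rewrite char_ext0 => /eqP; rewrite eq_sym oner_eq0.
apply/eqP; have := char_ext_orthogonality x.
rewrite (eq_bigr (fun=> 1)) => [|i /(proj2 T_gen)[n ->]]; last first.
  by rewrite char_ext_exp // Tx expr1n.
case: eqP => // _; rewrite mulr0 sumr_const => /eqP.
rewrite pnatr_eq0 => /eqP/card0_eq/(_ (0 : Iirr _)).
rewrite [X in X = _](_ : _ = true) //.
exact/irr_cyclic_lin/field_unit_group_cyclic.
Qed.

Section Order.
Variables (n m : nat).
Hypotheses (n_gt0 : (0 < n)%N) (cardF : #|F|.-1 = (n * m)%N).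

(** Faithfulness of [T] gives [x ^+ m = 1]. For [x = g ^+ i] this says that [n * m] divides [i * m],
    hence [n] divides [i]. *)
Lemma char_generator_power x : x != 0 ->
  char_ext (T ^+ m) x = 1 -> exists y, x = y ^+ n.
Proof.
move=> nz_x; rewrite char_ext_exp // -char_extX // => /char_generator_inj xm1.
have [g prim_g] := finField_prim_root.
have [i def_x] := prim_root_log prim_g nz_x.
have m_gt0 : (0 < m)%N.
  by have := prim_order_gt0 prim_g; rewrite cardF muln_gt0 => /andP[].
move/eqP: xm1; rewrite def_x -exprM -(prim_order_dvd prim_g) cardF.
by rewrite dvdn_pmul2r // => /dvdnP[j ->]; exists (g ^+ j); rewrite exprM.
Qed.

(* The geometric sum on the right is [n] if [u] is an [n]-th power, and [0]
   otherwise. *)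
Lemma card_nth_roots (u : F) : u != 0 ->
  (#|[set w : F | w ^+ n == u]|)%:R = \sum_(i < n) char_ext (T ^+ m) u ^+ i.
Proof.
move=> nz_u; have [g prim_g] := finField_prim_root.
have [eta1|eta_neq1] := eqVneq (char_ext (T ^+ m) u) 1.
  rewrite eta1 (eq_bigr (fun=> 1)) => [|i _]; last by rewrite expr1n.
  have [w def_u] := char_generator_power nz_u eta1.
  have nz_w : w != 0.
    by apply: contraNneq nz_u => w0; rewrite def_u w0 expr0n gtn_eqF.
  have prim_z : n.-primitive_root (g ^+ m).
    have n_dvd : (n %| #|F|.-1)%N by rewrite cardF dvdn_mulr.
    by have := dvdn_prim_root prim_g n_dvd; rewrite cardF mulKn.
  rewrite sumr_const card_ord; congr _%:R.
  (* The [n]-th roots of [u] form the coset of [w] under the group generated by [g ^+ m]. *)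
  have card_coset : #|[set w * (g ^+ m) ^+ nat_of_ord i | i : 'I_n]| = n.
    rewrite card_imset ?card_ord // => i j /(mulfI nz_w)/eqP.
    by rewrite (eq_prim_root_expr prim_z) !modn_small // => /eqP/val_inj.
  rewrite -[RHS]card_coset; apply: eq_card => v; rewrite inE.
  apply/eqP/imsetP => [vn|[i _ ->]].
    have: (v / w) ^+ n = 1 by rewrite expr_div_n vn -def_u divff.
    by case/(prim_rootP prim_z) => i vw; exists i; rewrite // -vw mulrC divfK.
  by rewrite exprMn -def_u (exprAC (g ^+ m)) (prim_expr_order prim_z) expr1n mulr1.
rewrite (_ : [set _ | _] = set0) ?cards0; last first.
  apply/setP => w; rewrite !inE; apply/negP => /eqP def_u.
  have nz_w : w != 0.
    by apply: contraNneq nz_u => w0; rewrite -def_u w0 expr0n gtn_eqF.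
  case/eqP: eta_neq1; rewrite -def_u char_ext_exp; last by rewrite def_u.
  by rewrite -char_extX // -exprM -cardF finField_expf_pred ?char_ext1.
(* Multiplied by its ratio minus 1, the geometric sum telescopes to [T (u ^+ (n * m)) - 1 = 0]. *)
apply/esym/eqP; rewrite -(inj_eq (mulfI (_ : char_ext (T ^+ m) u - 1 != 0))).
  rewrite -subrX1 mulr0 subr_eq0 char_ext_exp // -exprM mulnC -cardF.
  by rewrite -char_extX // finField_expf_pred // char_ext1.
by rewrite subr_eq0.
Qed.
End Order.
End PowerResidue.

(** * Greene's series as a character sum over pairs *)

Lemma greene_2F1E (F : finFieldType) (A B : mulcf F) (x : F) :
  #|F|%:R * greene_2F1 A B 1 x
  = \sum_a \sum_b char_ext A a * char_ext B b
      * (a / (1 - a) * (b / (1 - b)) * x == 1)%:R.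
Proof.
have cardF : #|F|%:R != 0 :> algC by rewrite pnatr_eq0 -lt0n ltnW ?finNzRing_gt1.
have cardF1 : #|F|%:R - 1 != 0 :> algC.
  by rewrite subr_eq0 pnatr_eq1 gtn_eqF ?finNzRing_gt1.
(* At [a = 1] the convention [0^-1 = 0] agrees with [chi 0 = 0], so the two character values merge
   without exception. *)
have binomE C (chi : mulcf F) : chi \is a linear_char ->
    greene_binom (C * chi) chi
    = char_ext chi (-1) / #|F|%:R * \sum_a char_ext C a * char_ext chi (a / (1 - a)).
  move=> lin_chi; rewrite /greene_binom; congr (_ * _); apply: eq_bigr => a _.
  by rewrite char_ext_mul char_ext_inv // -mulrA -char_extM.
rewrite /greene_2F1.
have -> : \sum_(i : Iirr (units_grp F) | 'chi_i \is a linear_char)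
      greene_binom (A * 'chi_i) 'chi_i * greene_binom (B * 'chi_i) (1 * 'chi_i)
      * char_ext 'chi_i x
    = #|F|%:R ^- 2 * \sum_a \sum_b char_ext A a * char_ext B b
      * \sum_(i : Iirr (units_grp F) | 'chi_i \is a linear_char)
          char_ext 'chi_i (a / (1 - a) * (b / (1 - b)) * x).
  transitivity (\sum_(i : Iirr (units_grp F) | 'chi_i \is a linear_char)
    #|F|%:R ^- 2 * \sum_a \sum_b char_ext A a * char_ext B b
          * char_ext 'chi_i (a / (1 - a) * (b / (1 - b)) * x)).
    apply: eq_bigr => i lin_i; rewrite mul1r !binomE //.
    (* The signs [chi (-1)] of the two binomials cancel. *)
    have sqrN1 : char_ext 'chi_i (-1) * char_ext 'chi_i (-1) = 1.
      by rewrite -char_extM // mulrNN mulr1 char_ext1.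
    set s := char_ext 'chi_i (-1) in sqrN1 *.
    set X := \sum_a char_ext A a * char_ext _ _.
    set Y := \sum_a char_ext B a * char_ext _ _.
    transitivity (s * s * #|F|%:R ^- 2 * (X * Y * char_ext 'chi_i x)); first by field.
    rewrite sqrN1 mul1r; congr (_ * _).
    rewrite /X mulr_suml mulr_suml; apply: eq_bigr => a _.
    rewrite /Y mulr_sumr mulr_suml; apply: eq_bigr => b _.
    rewrite !char_extM //; ring.
  rewrite -mulr_sumr exchange_big; congr (_ * _); apply: eq_bigr => a _.
  by rewrite exchange_big; apply: eq_bigr => b _; rewrite mulr_sumr.
rewrite !mulrA mulr_sumr; apply: eq_bigr => a _.
rewrite mulr_sumr; apply: eq_bigr => b _.
rewrite char_ext_orthogonality; field.
by rewrite cardF cardF1.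
Qed.

Lemma sum_fibers (I J : finType) (P : pred I) (h : I -> J) (g : J -> algC) :
  \sum_(w | P w) g (h w) = \sum_s (#|[set w | P w & h w == s]|)%:R * g s.
Proof.
rewrite (partition_big h predT) //=; apply: eq_bigr => s _.
rewrite (eq_bigr (fun=> g s)) => [|w /andP[_ /eqP-> //]].
rewrite sumr_const [RHS]mulr_natl; congr (_ *+ _).
by apply: eq_card => w; rewrite [RHS]inE.
Qed.

(** Translation by 1 permutes [F] and adds [#|F|] to the sum of all its elements. *)
Lemma natr_card_finField (F : finFieldType) : #|F|%:R = 0 :> F.
Proof.
have: \sum_(x : F) x = \sum_(x : F) (x + 1).
  by rewrite [LHS](reindex_inj (addIr 1)).
by rewrite big_split /= sumr_const -[LHS]addr0 => /addrI/esym.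
Qed.

(** * Quadratic, cubic and sextic characters for [q = 6k + 1] *)

Section SexticCharacters.
Variables (F : finFieldType) (k : nat) (T : mulcf F).
Hypotheses (cardF : #|F| = (6 * k).+1) (T_gen : char_generator T).
Let lin_T : T \is a linear_char := proj1 T_gen.

Let phi := char_ext (T ^+ (3 * k)).
Let omega := char_ext (T ^+ (2 * k)).
Let rho := char_ext (T ^+ (5 * k)).

Lemma lin_charXn n : T ^+ n \is a linear_char.
Proof. exact: rpredX. Qed.

Lemma six_neq0 : 6 != 0 :> F.
Proof.
have := natr_card_finField F; rewrite cardF -natr1 natrM => /eqP.
by apply: contraTneq => ->; rewrite mul0r add0r oner_eq0.
Qed.

Lemma two_neq0 : 2 != 0 :> F.
Proof. by apply: contraNneq six_neq0 => two0; rewrite (natrM _ 2 3) two0 mul0r. Qed.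

Lemma three_neq0 : 3 != 0 :> F.
Proof. by apply: contraNneq six_neq0 => three0; rewrite (natrM _ 2 3) three0 mulr0. Qed.

Lemma four_neq0 : 4 != 0 :> F.
Proof. by rewrite (natrM _ 2 2) mulf_neq0 ?two_neq0. Qed.

Lemma k_gt0 : (0 < k)%N.
Proof. by have := finNzRing_gt1 F; rewrite cardF; case: k. Qed.

Lemma cardF2 : #|F|.-1 = (2 * (3 * k))%N. Proof. by rewrite cardF; lia. Qed.
Lemma cardF3 : #|F|.-1 = (3 * (2 * k))%N. Proof. by rewrite cardF; lia. Qed.

Lemma phiM : {morph phi : x y / x * y}.
Proof. exact/char_extM/lin_charXn. Qed.

Lemma phi0 : phi 0 = 0. Proof. exact: char_ext0. Qed.

Lemma phi_sqr x : x != 0 -> phi (x ^+ 2) = 1.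
Proof.
move=> nz_x; rewrite /phi char_ext_exp ?expf_neq0 // -char_extX //.
by rewrite -exprM -cardF2 finField_expf_pred // char_ext1.
Qed.

Lemma phi_sqrM x y : x != 0 -> phi (x ^+ 2 * y) = phi y.
Proof. by move=> nz_x; rewrite phiM phi_sqr ?mul1r. Qed.

Lemma card_sqrt (D : F) : (#|[set w : F | w ^+ 2 == D]|)%:R = 1 + phi D.
Proof.
have [->|nz_D] := eqVneq D 0.
  rewrite phi0 addr0 (_ : [set _ | _] = [set 0]) ?cards1 //.
  by apply/setP => w; rewrite !inE sqrf_eq0.
by rewrite (card_nth_roots T_gen _ cardF2) // !big_ord_recr big_ord0 /=
  add0r expr0 expr1.
Qed.

(** Completing the square: [2 * a * y + b] runs over the square roots of the discriminant. *)
Lemma card_quadratic_roots (a b c : F) : a != 0 ->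
  (#|[set y | a * y ^+ 2 + b * y + c == 0]|)%:R = 1 + phi (b ^+ 2 - 4 * a * c).
Proof.
move=> nz_a; rewrite -card_sqrt; congr _%:R.
have nz_2a : 2 * a != 0 by rewrite mulf_neq0 ?two_neq0.
have inj_f : injective (fun y => 2 * a * y + b) by move=> y z /addIr/(mulfI nz_2a).
rewrite -[LHS](card_imset _ inj_f); apply: eq_card => w; rewrite [RHS]inE.
apply/imsetP/eqP => [[y /[!inE]/eqP root_y ->]|sqr_w].
  transitivity (4 * a * (a * y ^+ 2 + b * y + c) + (b ^+ 2 - 4 * a * c)).
    by ring.
  by rewrite root_y mulr0 add0r.
exists ((w - b) / (2 * a)); last by field; rewrite ?nz_a ?two_neq0.
rewrite inE; apply/eqP.
transitivity ((w ^+ 2 - (b ^+ 2 - 4 * a * c)) / (4 * a)).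
  by field; rewrite ?nz_a ?two_neq0 ?four_neq0.
by rewrite sqr_w subrr mul0r.
Qed.

(** Since 3 divides [q - 1] there is a primitive cube root of unity [z], and [(2z + 1)^2 = -3]. *)
Lemma phi_N3 : phi (-3) = 1.
Proof.
have [g prim_g] := finField_prim_root F.
have dvd3 : (3 %| #|F|.-1)%N by rewrite cardF3 dvdn_mulr.
have := dvdn_prim_root prim_g dvd3; set z := g ^+ _ => prim_z.
have z_neq1 : z != 1 by rewrite -[z]expr1 -(prim_order_dvd prim_z).
have sum_z : z ^+ 2 + z + 1 = 0.
  apply: (mulfI (_ : z - 1 != 0)); first by rewrite subr_eq0.
  transitivity (z ^+ 3 - 1); first by ring.
  by rewrite (prim_expr_order prim_z) subrr mulr0.
have def_N3 : -3 = (2 * z + 1) ^+ 2 :> F.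
  by apply/eqP; rewrite -subr_eq0 -(mulr0 (-4)) -sum_z; apply/eqP; ring.
rewrite def_N3 phi_sqr //; apply: contraNneq three_neq0 => zz.
by rewrite -oppr_eq0 def_N3 zz expr0n.
Qed.

(** * The substitutions [w + 1/w] and [w^3], and the cubic [s^3 - 3s] *)

Lemma sum_add_inv (f : F -> algC) :
  \sum_(w | w != 0) f (w + w^-1) = \sum_s (1 + phi (s ^+ 2 - 4)) * f s.
Proof.
rewrite (sum_fibers _ _ f); apply: eq_bigr => s _; congr (_ * _).
(* The fibre over [s] is the root set of [w^2 - s w + 1], which omits 0. *)
have -> : s ^+ 2 - 4 = (- s) ^+ 2 - 4 * 1 * 1 :> F by ring.
rewrite -card_quadratic_roots ?oner_neq0 //; congr _%:R.
apply: eq_card => w; rewrite !inE.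
have [->|nz_w] := eqVneq w 0; first by rewrite expr0n !mulr0 !add0r oner_eq0.
rewrite /= -(inj_eq (mulfI nz_w)) -subr_eq0; congr (_ == 0).
by field.
Qed.

Lemma sum_cube (f : F -> algC) :
  \sum_(w | w != 0) f (w ^+ 3)
  = \sum_(u | u != 0) (1 + omega u + omega u ^+ 2) * f u.
Proof.
rewrite (sum_fibers _ _ f) (bigD1 0) //=.
rewrite (_ : [set _ | _ & _] = set0) ?cards0 ?mul0r ?add0r; last first.
  by apply/setP => w; rewrite !inE expf_eq0 /= andNb.
apply: eq_bigr => u nz_u; congr (_ * _).
transitivity (#|[set w : F | w ^+ 3 == u]|%:R : algC).
  congr _%:R; apply: eq_card => w; rewrite !inE.
  by case: eqP => [->|//]; rewrite expr0n eq_sym (negPf nz_u).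
by rewrite (card_nth_roots T_gen _ cardF3) // !big_ord_recr big_ord0 /=
  add0r expr0 expr1.
Qed.

Lemma omega_inv u : u != 0 -> omega u^-1 = omega u ^+ 2.
Proof.
move=> nz_u; have om0 : omega u != 0 by apply: char_ext_neq0 => //; exact: lin_charXn.
apply: (mulfI om0); rewrite -exprS -char_extM ?divff ?char_ext1 //;
  try exact: lin_charXn.
rewrite /omega char_ext_exp // -!exprM mulnC.
have -> : (3 * (2 * k) = #|F|.-1)%N by rewrite cardF3.
by rewrite -char_extX // finField_expf_pred // char_ext1.
Qed.

(* [s |-> s^3 - 3s] permutes the set where [s^2 - 4] is zero or a nonsquare
   and preserves [phi (s^2 - 4)] there, since
   [(s^3 - 3s)^2 - 4 = (s^2 - 4) (s^2 - 1)^2]. *)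
Lemma sum_dickson_nonsquare (f : F -> algC) :
  \sum_s (1 - phi (s ^+ 2 - 4)) * f (s ^+ 3 - 3 * s)
  = \sum_s (1 - phi (s ^+ 2 - 4)) * f s.
Proof.
pose g s : F := s ^+ 3 - 3 * s; pose B := [set s | phi (s ^+ 2 - 4) != 1].
have g_disc s : g s ^+ 2 - 4 = (s ^+ 2 - 1) ^+ 2 * (s ^+ 2 - 4) by rewrite /g; ring.
(* If [s^2 = 1] then [s^2 - 4 = -3] is a square, so [s] is outside [B]. *)
have sqr1B s : s \in B -> s ^+ 2 - 1 != 0.
  rewrite inE; apply: contraNneq => /eqP; rewrite subr_eq0 => /eqP ->.
  by rewrite -phi_N3; apply/eqP; congr phi; ring.
have phi_g s : s \in B -> phi (g s ^+ 2 - 4) = phi (s ^+ 2 - 4).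
  by move=> Bs; rewrite g_disc phi_sqrM ?sqr1B.
have sumB (h : F -> algC) : \sum_s (1 - phi (s ^+ 2 - 4)) * h s
    = \sum_(s in B) (1 - phi (s ^+ 2 - 4)) * h s.
  rewrite [RHS]big_mkcond; apply: eq_bigr => s _; rewrite inE.
  by case: eqP => [->|//]; rewrite subrr mul0r.
have g_inj : {in B &, injective g}.
  move=> s t Bs Bt eq_g; apply: contraTeq Bs => neq_st.
  (* Dividing [g s = g t] by [s - t] leaves [s^2 + s t + t^2 = 3]. Completing the square and using
     that -3 is a square makes [s^2 - 4] a square. *)
  have eq_st : (2 * t + s) ^+ 2 = -3 * (s ^+ 2 - 4).
    apply: (mulfI (_ : s - t != 0)); first by rewrite subr_eq0.
    apply/eqP; rewrite -subr_eq0.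
    rewrite (_ : _ - _ = 4 * (g s - g t)); last by rewrite /g; ring.
    by rewrite eq_g subrr mulr0.
  (* The case [s^2 = 4] does lie in [B], so it is excluded through [t]: then [s = -2t] and
     [t^2 - 4 = -3], a square. *)
  have nz_s4 : s ^+ 2 - 4 != 0.
    apply: contraTneq Bt => s4; rewrite inE negbK.
    have : (2 * t + s) ^+ 2 == 0 by rewrite eq_st s4 mulr0.
    rewrite sqrf_eq0 addrC addr_eq0 => /eqP def_s.
    have : t ^+ 2 - 4 = -3.
      apply: (mulfI four_neq0); transitivity (s ^+ 2 - 4 - 12).
        by rewrite def_s; ring.
      by rewrite s4; ring.
    by move->; rewrite phi_N3.
  rewrite inE negbK.
  have -> : phi (s ^+ 2 - 4) = phi (-3 * (s ^+ 2 - 4)) by rewrite phiM phi_N3 mul1r.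
  rewrite -eq_st phi_sqr //.
  rewrite -sqrf_eq0 eq_st mulf_neq0 // oppr_eq0; exact: three_neq0.
rewrite !sumB (eq_bigr (fun s => (1 - phi (g s ^+ 2 - 4)) * f (g s))); last first.
  by move=> s Bs; rewrite phi_g.
rewrite -(big_imset (fun s => (1 - phi (s ^+ 2 - 4)) * f s) g_inj).
(* An injective self-map of the finite set [B] is onto. *)
apply: eq_bigl => s; suff -> : g @: B = B by []; apply/eqP.
rewrite eqEcard card_in_imset // leqnn andbT.
by apply/subsetP => _ /imsetP[t Bt ->]; move: (Bt); rewrite !inE phi_g.
Qed.

(* Cardano: the number of roots of [s^3 - 3s = m] is [1] plus the sum of
   [omega u] over the solutions of [u + 1/u = m]. *)
Lemma sum_cardano (f : F -> algC) :
  \sum_s f (s ^+ 3 - 3 * s)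
  = \sum_m f m + \sum_(u | u != 0) omega u * f (u + u^-1).
Proof.
pose g s : F := s ^+ 3 - 3 * s.
have cubes : \sum_(w | w != 0) f (w ^+ 3 + (w ^+ 3)^-1)
    = \sum_s (1 + phi (s ^+ 2 - 4)) * f (g s).
  rewrite -(sum_add_inv (fun s => f (g s))); apply: eq_bigr => w nz_w.
  by congr f; rewrite /g; field.
(* Inversion of [u] exchanges [omega] and its square while fixing [u + 1/u]. *)
have omega2 : \sum_(u | u != 0) omega u ^+ 2 * f (u + u^-1)
    = \sum_(u | u != 0) omega u * f (u + u^-1).
  rewrite [RHS](reindex_inj invr_inj); apply: eq_big => [u|u nz_u].
    by rewrite invr_eq0.
  by rewrite omega_inv // invrK addrC.
move: cubes; rewrite (sum_cube (fun u => f (u + u^-1))).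
have dist1 (P : pred F) (a b : F -> algC) :
    \sum_(s | P s) (1 + a s) * b s = \sum_(s | P s) b s + \sum_(s | P s) a s * b s.
  by rewrite -big_split; apply: eq_bigr => s _; rewrite mulrDl mul1r.
have dist1N (a b : F -> algC) :
    \sum_s (1 - a s) * b s = \sum_s b s - \sum_s a s * b s.
  by rewrite -sumrB; apply: eq_bigr => s _; rewrite mulrBl mul1r.
under eq_bigr do rewrite -addrA; rewrite dist1.
under [X in _ + X = _]eq_bigr do rewrite mulrDl.
rewrite big_split /= omega2 sum_add_inv !dist1.
have := sum_dickson_nonsquare f; rewrite !dist1N -/g.
set A := \sum_s f _; set B := \sum_s phi _ * _.
set C := \sum_s f _; set D := \sum_s phi _ * f _; set O := \sum_(u | _) _.
(* [e1] carries the weights [1 - phi] and [e2] the weights [1 + phi]; their sum is twice the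
   claim. *)
move=> e1 e2; apply: (mulfI (_ : 2 != 0 :> algC)); first by rewrite pnatr_eq0.
apply/eqP; rewrite -subr_eq0.
rewrite (_ : _ - _ = (A - B - (C - D)) + (A + B - (C + D + (O + O)))); last by ring.
by rewrite e1 e2 !subrr addr0.
Qed.

Lemma char_generator_sum0 n : ~~ (#|F|.-1 %| n)%N -> \sum_x char_ext (T ^+ n) x = 0.
Proof.
have [g prim_g] := finField_prim_root F; rewrite (prim_order_dvd prim_g) => gn.
have nz_g : g != 0.
  apply: contraTneq prim_g => ->; rewrite cardF /=.
  apply/negP => /prim_expr_order/eqP.
  by rewrite expr0n eq_sym muln_eq0 /= gtn_eqF ?k_gt0 // oner_eq0.
apply: (char_ext_sum0 (lin_charXn n) nz_g); rewrite char_ext_exp // -char_extX //.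
by apply: contraNneq gn => /(char_generator_inj T_gen)->.
Qed.

Lemma sum_phi : \sum_x phi x = 0.
Proof.
apply: char_generator_sum0; rewrite cardF /=.
by apply/negP => /dvdn_leq; have := k_gt0; lia.
Qed.

Lemma sum_rho : \sum_x rho x = 0.
Proof.
apply: char_generator_sum0; rewrite cardF /=.
by apply/negP => /dvdn_leq; have := k_gt0; lia.
Qed.

Lemma rhoM : {morph rho : x y / x * y}.
Proof. exact/char_extM/lin_charXn. Qed.

Lemma rhoE u : rho u = omega u * phi u.
Proof.
by rewrite /rho /omega /phi -char_ext_mul -exprD -mulnDl.
Qed.

(** As -1 is its own inverse, [omega (-1)] equals its square. This is what makes [rho (-1)] equal to
    [phi (-1)] in the end. *)
Lemma omegaN1 : omega (-1) = 1.
Proof.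
have om0 : omega (-1) != 0.
  by apply: char_ext_neq0; rewrite ?oppr_eq0 ?oner_eq0 //; exact: lin_charXn.
apply: (mulfI om0); rewrite mulr1 -expr2 -omega_inv ?invrN ?invr1 //.
by rewrite oppr_eq0 oner_eq0.
Qed.

(** * Hypergeometric side: reduction to [rho] and [phi] *)

Lemma char_ext_rhoV a : char_ext (T ^+ k) a = rho a^-1.
Proof.
have [->|nz_a] := eqVneq a 0; first by rewrite invr0 /rho !char_ext0.
have nz_ra : rho a != 0 by apply: char_ext_neq0 => //; exact: lin_charXn.
apply: (mulfI nz_ra); rewrite -rhoM divff // /rho !char_ext1; last exact: lin_charXn.
rewrite -char_ext_mul -exprD char_ext_exp // -char_extX //.
have -> : (5 * k + k)%N = #|F|.-1 by rewrite cardF; lia.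
by rewrite finField_expf_pred // char_ext1.
Qed.

Lemma greene_2F1_rho x : x != 0 ->
  #|F|%:R * greene_2F1 (T ^+ k) (T ^+ (5 * k)) 1 x
  = \sum_b rho (b * (1 - b + b * x) / (1 - b)).
Proof.
move=> nz_x; rewrite greene_2F1E exchange_big /=; apply: eq_bigr => b _.
(* The unique solution in [a] of [a b x = (1 - a)(1 - b)]. *)
pose a0 := (1 - b) / (1 - b + b * x).
rewrite (bigD1 a0) //= [X in _ + X]big1 ?addr0.
  (* In the degenerate cases some quotient has numerator or denominator 0 and so is 0: the indicator
     fails, and the right side is [rho 0 = 0]. *)
  have [den|ndiv] := boolP [&& b != 0, 1 - b != 0 & 1 - b + b * x != 0].
    have /and3P[nz_b nz_1b nz_den] := den.
    have def_1a : 1 - a0 = b * x / (1 - b + b * x) by rewrite /a0; field.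
    have -> : a0 / (1 - a0) * (b / (1 - b)) * x = 1.
      by rewrite def_1a /a0; field; rewrite nz_1b nz_den nz_b nz_x.
    rewrite eqxx mulr1 char_ext_rhoV -rhoM; congr rho.
    by rewrite /a0; field; rewrite nz_1b nz_den.
  have -> : b * (1 - b + b * x) / (1 - b) = 0.
    move: ndiv; rewrite !negb_and !negbK => /or3P[]/eqP->; rewrite ?mul0r //.
      by rewrite invr0 mulr0.
    by rewrite mulr0 mul0r.
  rewrite /rho char_ext0 (_ : _ == 1 = false) ?mulr0 //.
  apply: contraNF ndiv => /eqP e.
  rewrite /a0 in e; apply/and3P; split; apply: contra_eq_neq e => ->.
  - by rewrite !(mul0r, mulr0, invr0) eq_sym oner_eq0.
  - by rewrite !(mul0r, mulr0, invr0) eq_sym oner_eq0.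
  - by rewrite !(mul0r, mulr0, invr0) eq_sym oner_eq0.
move=> a ne_a; case: eqP => [e|_]; last by rewrite mulr0.
case/eqP: ne_a.
have nz_1a : 1 - a != 0.
  by apply: contra_eq_neq e => ->; rewrite invr0 mulr0 !mul0r eq_sym oner_eq0.
have nz_1b : 1 - b != 0.
  by apply: contra_eq_neq e => ->; rewrite invr0 !mulr0 mul0r eq_sym oner_eq0.
have e2 : a * (1 - b + b * x) = 1 - b.
  have : a * b * x = (1 - a) * (1 - b).
    transitivity ((1 - a) * (1 - b) * (a / (1 - a) * (b / (1 - b)) * x)).
      by field; rewrite nz_1a nz_1b.
    by rewrite e mulr1.
  move=> e2; rewrite mulrDr mulrA e2; ring.
have nz_den : 1 - b + b * x != 0.
  by apply: contraNneq nz_1b => den0; rewrite -e2 den0 mulr0.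
by apply: (mulIf nz_den); rewrite e2 /a0 divfK.
Qed.

(** The fibre over [u] is cut out by [(x - 1) b^2 + (1 + u) b - u = 0], quadratic because [x != 1].
    The constant part of the root count contributes the sum of [rho], which is 0. *)
Lemma sum_rho_fibers x : x != 0 -> x != 1 ->
  \sum_b rho (b * (1 - b + b * x) / (1 - b))
  = rho (-1) * \sum_u rho u * phi ((u + 1) ^+ 2 - 4 * x * u).
Proof.
move=> nz_x x_neq1.
rewrite (sum_fibers predT (fun b => b * (1 - b + b * x) / (1 - b)) rho).
transitivity (\sum_u (1 + phi ((u - 1) ^+ 2 + 4 * x * u)) * rho u).
  apply: eq_bigr => u _; have [->|nz_u] := eqVneq u 0.
    by rewrite /rho char_ext0 !mulr0.
  congr (_ * _).
  have -> : (u - 1) ^+ 2 + 4 * x * u = (1 + u) ^+ 2 - 4 * (x - 1) * (- u) by ring.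
  rewrite -card_quadratic_roots ?subr_eq0 //; congr _%:R.
  apply: eq_card => b; rewrite !inE /=.
  (* At [b = 1] the quotient is 0 by convention, hence not [u], and the quadratic takes the value
     [x], which is nonzero. *)
  have [/eqP|nz_1b] := eqVneq (1 - b) 0.
    rewrite subr_eq0 => /eqP <-; rewrite subrr invr0 mulr0 eq_sym (negPf nz_u).
    have -> : (x - 1) * 1 ^+ 2 + (1 + u) * 1 - u = x by ring.
    by rewrite (negPf nz_x).
  rewrite -(inj_eq (mulIf nz_1b)) divfK // -subr_eq0; congr (_ == 0); ring.
under eq_bigr do rewrite mulrDl mul1r; rewrite big_split /= sum_rho add0r.
rewrite (reindex_inj oppr_inj) mulr_sumr; apply: eq_bigr => u _ /=.
have -> : (- u - 1) ^+ 2 + 4 * x * - u = (u + 1) ^+ 2 - 4 * x * u by ring.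
by rewrite -(mulN1r u) rhoM [LHS]mulrC mulrA.
Qed.

(** * Elliptic side: the cubic character sum and the trace *)

Lemma sum_phi_cubic (c d : F) : c != 0 ->
  \sum_t phi (t ^+ 3 + c * t ^+ 2 + d)
  = phi (3 * c) * \sum_u rho u
      * phi ((u + 1) ^+ 2 - 4 * (- (27 * d / (4 * c ^+ 3))) * u).
Proof.
move=> nz_c.
have nz2 := two_neq0; have nz3 := three_neq0; have nz4 := four_neq0.
have nz9 : 9 != 0 :> F by rewrite (natrM _ 3 3) mulf_neq0.
have nz27 : 27 != 0 :> F by rewrite (natrM _ 3 9) mulf_neq0.
pose f m := phi (c ^+ 3 / 27 * (m + 2) + d).
have inj_t : injective (fun s : F => c / 3 * (s - 1)).
  by move=> s t /(mulfI _)/addIr -> //; rewrite mulf_neq0 ?invr_neq0.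
have inj_m : injective (fun m : F => c ^+ 3 / 27 * (m + 2) + d).
  by move=> s t /addIr/(mulfI _)/addIr -> //; rewrite mulf_neq0 ?invr_neq0 ?expf_neq0.
rewrite (reindex_inj inj_t) /=.
transitivity (\sum_s f (s ^+ 3 - 3 * s)).
  by apply: eq_bigr => s _; congr phi; field; rewrite ?nz3 ?nz27.
(* The main term of Cardano's formula is [phi] summed along an affine bijection. *)
have sum_f : \sum_m f m = 0.
  by rewrite -[RHS]sum_phi [RHS](reindex_inj inj_m); apply: eq_bigr.
rewrite sum_cardano sum_f add0r mulr_sumr [RHS](bigD1 0) //=.
rewrite {1}/rho char_ext0 mul0r mulr0 add0r.
apply: eq_bigr => u nz_u; rewrite rhoE /f; set Q := _ - _.
(* Once the square is removed, the factor [phi u] combines with [omega u] into [rho u]. *)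
have -> : c ^+ 3 / 27 * (u + u^-1 + 2) + d = (c / (9 * u)) ^+ 2 * (3 * c * u * Q).
  by rewrite /Q; field; rewrite ?nz_c ?nz_u ?nz4 ?nz9 ?nz27.
rewrite phi_sqrM ?mulf_neq0 ?invr_neq0 ?mulf_neq0 // 2!phiM; ring.
Qed.

(** Each abscissa carries 1 plus [phi] of the cubic many points; the ones and the point at infinity
    cancel [q + 1]. *)
Lemma trace_frobenius_phi (c d : F) :
  (trace_frobenius (Weierstrass 0 c 0 0 d))%:~R
  = - \sum_t phi (t ^+ 3 + c * t ^+ 2 + d).
Proof.
rewrite /trace_frobenius; set E := Weierstrass 0 c 0 0 d.
pose A := [set P : F * F | on_curve E P.1 P.2].
have -> : curve_points E = None |: (Some @: A).
  apply/setP => [[[x y]|]]; rewrite !inE //=.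
  by rewrite (mem_imset _ _ Some_inj) inE.
have None_notin : None \notin Some @: A by apply/imsetP => -[].
rewrite cardsU1 None_notin (card_imset _ Some_inj).
rewrite !rmorphB rmorphD /= -!pmulrn natrD.
have -> : #|A|%:R = \sum_(x : F) (1 + phi (x ^+ 3 + c * x ^+ 2 + d)) :> algC.
  rewrite -sum1dep_card natr_sum.
  rewrite -(pair_big_dep predT (fun x y => on_curve E x y) (fun _ _ => 1)) /=.
  apply: eq_bigr => x _; rewrite -card_sqrt -sum1dep_card natr_sum.
  by apply: eq_bigl => y; rewrite /on_curve /= !mul0r !addr0.
by rewrite big_split /= sumr_const; ring.
Qed.

End SexticCharacters.

Theorem theorem3p1 (p e q : nat) (F : finFieldType)
    (p_prime : prime p) (q_def : q = (p ^ e)%N) (card_F : #|F| = q)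
    (q_mod6 : q = 1 %[mod 6])
    (c d : F) (c_neq0 : c != 0)
    (E1_elliptic : elliptic (Weierstrass 0 c 0 0 d))
    (T : 'CF([set: {unit F}]%G)) (T_gen : char_generator T) :
  (trace_frobenius (Weierstrass 0 c 0 0 d))%:~R
  = - q%:R * char_ext (T ^+ ((q - 1) %/ 2)) (- (3 * c))
    * greene_2F1 (T ^+ ((q - 1) %/ 6)) (T ^+ (5 * (q - 1) %/ 6)) 1
        (- (27 * d / (4 * c ^+ 3)))
  :> algC.
Proof.
pose k := ((q - 1) %/ 6)%N.
have cardF : #|F| = (6 * k).+1.
  have := finNzRing_gt1 F; rewrite card_F => q_gt1.
  have := divn_eq q 6; rewrite q_mod6 /k => ->; lia.
have nz2 := two_neq0 cardF; have nz3 := three_neq0 cardF; have nz4 := four_neq0 cardF.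
have nz27 : 27 != 0 :> F by rewrite (natrM _ 3 9) (natrM _ 3 3) !mulf_neq0.
(* The two candidate singular points below are rational, so the trivial extension suffices. *)
have elliptic_F := E1_elliptic F (idfun : {rmorphism F -> F}).
have nz_d : d != 0.
  apply: contraNneq (elliptic_F 0 0) => ->.
  by rewrite /singular_at /on_curve /=; apply/and3P; split; apply/eqP; ring.
(* The cubic has critical points 0 and [-2c/3]. It vanishes at the former when [d = 0] and at the
   latter when [4c^3 + 27d = 0]; excluding these gives [x != 0] and [x != 1]. *)
have disc : 4 * c ^+ 3 + 27 * d != 0.
  apply: contraNneq (elliptic_F (- (2 * c / 3)) 0) => disc0.
  have def_d : d = - (4 * c ^+ 3 / 27).
    apply: (mulfI nz27); transitivity (4 * c ^+ 3 + 27 * d - 4 * c ^+ 3); first by ring.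
    by rewrite disc0; field.
  rewrite /singular_at /on_curve /= def_d.
  by apply/and3P; split; apply/eqP; field; rewrite ?nz3 ?nz27.
set x := - (27 * d / (4 * c ^+ 3)).
have nz_x : x != 0.
  by rewrite oppr_eq0 !mulf_neq0 ?invr_neq0 // mulf_neq0 ?expf_neq0.
have x_neq1 : x != 1.
  apply: contraNneq disc => x1; have <- : 4 * c ^+ 3 * (1 - x) = 4 * c ^+ 3 + 27 * d.
    by rewrite /x; field; rewrite c_neq0 nz4.
  by rewrite x1 subrr mulr0.
have -> : ((q - 1) %/ 2 = 3 * k)%N by rewrite -card_F cardF; lia.
have -> : (5 * (q - 1) %/ 6 = 5 * k)%N by rewrite -card_F cardF; lia.
rewrite -/k -card_F -mulrA mulNr mulrCA greene_2F1_rho //.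
rewrite (sum_rho_fibers cardF T_gen) //.
rewrite (trace_frobenius_phi cardF T_gen) (sum_phi_cubic cardF T_gen) //.
have -> : char_ext (T ^+ (5 * k)) (-1) = char_ext (T ^+ (3 * k)) (-1).
  by rewrite rhoE (omegaN1 cardF T_gen) mul1r.
(* The sign [phi (-1)] from the hypergeometric side turns [phi (-3c)] into [phi (3c)]. *)
by rewrite [in RHS]mulrA -(phiM k T_gen) mulrN1 opprK.
Qed.
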